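(* Let $n,q,\alpha,\beta\ge 1$ be integers with $\gcd(\alpha,\beta)=1$, and let $C(n,q\alpha)\in\{a<z\}^n$ and $C(n,q\beta)\in\{b<z\}^n$ be two superimposable Christoffel words. Let $(x,y)$ be the unique integer solution of $$x\alpha+y\beta=n-2\alpha\beta(q-1)$$ with $1\le y\le\alpha$. Then the number of superimpositions of $C(n,q\alpha)$ and $C(n,q\beta)$ is (i) $xy$, if $x\le\beta$; (ii) $x\alpha+y\beta-\alpha\beta$, if $x>\beta$.
   Context: For coprime $s,t\in\{0,1,2,\dots\}$ and $n=s+t$, the Christoffel word over the ordered alphabet $\{a<z\}$ with $s$ occurrences of $a$ and $t$ occurrences of $z$ is $u=u[0]u[1]\cdots u[n-1]$ with $u[i]=a$ if $((i+1)t \bmod n)>(it\bmod n)$ and $u[i]=z$ otherwise. It is denoted $C(n,s)$; calling $C(n,s)$ a Christoffel word presupposes $\gcd(n,s)=1$. Over $\{b<z\}$ the definition is the same with $b$ in place of $a$. For a letter $c$ and a finite word $w$, $\gamma(cw)=wc$; $\gamma$ is a bijection on words of a given length, and $\gamma^k$ is defined for all $k\in\mathbb Z$. Let $u\in\{a,z\}^n$ and $v\in\{b,z\}^m$, let $A$ be the set of positions (indexed from $0$) of the letter $a$ in $u$ and $B$ the set of positions of the letter $b$ in $v$. The words $u,v$ are perfectly superimposable if $(A+n\mathbb Z)\cap(B+m\mathbb Z)=\emptyset$, and superimposable if there is $k\in\mathbb Z$ with $(A+n\mathbb Z)\cap(B-k+m\mathbb Z)=\emptyset$ (equivalently, $u$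 and $\gamma^k(v)$ are perfectly superimposable for some $k$). The number of superimpositions of two superimposable Christoffel words $C(n,s)$ and $C(n,t)$ of the same length $n$ is the number of $k\in\{0,1,\dots,n-1\}$ such that $C(n,s)$ and $\gamma^kC(n,t)$ are perfectly superimposable.
   Formalization: The word C(1,1) is taken to be the one-letter word a (resp. b), as its letter counts require; the residue formula would give z, and the claim would then fail at n = q = α = β = 1 (one superimposition, but xy = 0). *)

(* Defs.v *)
From mathcomp Require Import all_boot all_order all_algebra.
From mathcomp Require Export boolp classical_sets.

Set Implicit Arguments.
Unset Strict Implicit.
Unset Printing Implicit Defensive.

Import GRing.Theory.
Local Open Scope ring_scope.
Local Open Scope classical_set_scope.

(* The three letters in play: words over {a < z} and words over {b < z} are
   both taken in [seq letter]. *)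
Inductive letter : Type := La | Lb | Lz.

(* [christoffel c n s] is C(n,s) over the alphabet {c < z}, with t = n - s
   occurrences of z; it is only meaningful for s <= n and coprime n s.
   The clause t = 0 concerns only C(1,1): that word has one occurrence of c
   and none of z, whereas all residues modulo n = 1 are equal, so that the
   comparison of residues alone would yield the letter z. *)
Definition christoffel (c : letter) (n s : nat) : seq letter :=
  let t := (n - s)%N in
  mkseq (fun i => if (t == 0%N) || ((i * t) %% n < (i.+1 * t) %% n)%N
                  then c else Lz) n.

Definition gamma (w : seq letter) : seq letter := rot 1 w.

Definition positions (c : letter) (w : seq letter) : set int :=
  [set p%:Z | p in [set p : nat | (p < size w)%N /\ nth Lz w p = c]].

(* S + mZ *)
Definition periodize (S : set int) (m : nat) : set int :=
  [set p + l * m%:Z | p in S & l in [set: int]].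

(* S - k *)
Definition shift (S : set int) (k : int) : set int := [set p - k | p in S].

Definition perfectly_superimposable (u v : seq letter) : Prop :=
  periodize (positions La u) (size u) `&` periodize (positions Lb v) (size v)
  = set0.

Definition superimposable (u v : seq letter) : Prop :=
  exists k : int,
    periodize (positions La u) (size u)
      `&` periodize (shift (positions Lb v) k) (size v) = set0.

(* Number of superimpositions of C(n,s) over {a < z} and C(n,t) over
   {b < z}. *)
Definition num_superimpositions (n s t : nat) : nat :=
  #|[pred k : 'I_n | `[< perfectly_superimposable (christoffel La n s)
                           (iter k gamma (christoffel Lb n t)) >]]|.

(* Main.v *)
Require Import Defs.
From mathcomp Require Import all_boot all_order all_algebra.
From mathcomp Require Import zify ring.
From mathcomp Require Import boolp classical_sets.

Import Order.TTheory GRing.Theory Num.Theory.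

Set Implicit Arguments.
Unset Strict Implicit.
Unset Printing Implicit Defensive.

Local Open Scope ring_scope.

(** Multiplying positions by the unit [- q alpha beta] modulo [n] turns the two
    periodic sets into [beta j] and [alpha j' + k q alpha beta], so the number
    of superimpositions is the number of classes modulo [n] that avoid
    [E = {beta j + alpha j' | 0 <= j < q alpha, 0 <= j' < q beta}].  Every
    integer is uniquely [beta j + alpha r + alpha beta f] with [0 <= j < alpha]
    and [0 <= r < beta]; call [f] its level: [E] is the set of integers of
    level in [[0, 2q-1[].  Since [n = x alpha + y beta + alpha beta (2q-2)],
    adding [n] raises the level by
    [2q-2 + (j + y) %/ alpha + (r + x) %/ beta].  If [x <= 0], a class climbs
    too slowly to jump over [E]; if [x > 0], the level is nondecreasing along
    a class and the classes avoiding [E] are in bijection with their last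
    elements of negative level.  For given [j] and [r] there are
    [max(0, (j + y) %/ alpha + (r + x) %/ beta - 1)] of these, and
    [\sum_(r < beta) (r + x) %/ beta = x] gives the total. *)

(** * Coefficients and level of an integer *)

(** For coprime [a] and [b], [(egcdz a b).2] inverts [b] modulo [a], so this is the residue of
    [m / b] modulo [a]. *)
Definition coef (a b m : int) : int := (m * (egcdz a b).2 %% a)%Z.

Definition level (a b m : int) : int :=
  ((m - b * coef a b m - a * coef b a m) %/ (a * b))%Z.

Lemma coef_bounds (a b m : int) : 0 < a -> 0 <= coef a b m < a.
Proof. by move=> a_gt0; rewrite modz_ge0 ?ltz_pmod ?gt_eqF. Qed.

Lemma dvdz_sub_coef (a b m : int) :
  coprimez a b -> (a %| m - b * coef a b m)%Z.
Proof.
rewrite /coprimez /coef => /eqP cab; case: egcdzP => u v.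
rewrite cab => uv _ /=.
have E := divz_eq (m * v) a.
set q := (_ %/ _)%Z in E; set r := (_ %% _)%Z in E *.
apply/dvdzP; exists (m * u + b * q).
have -> : r = m * v - q * a by rewrite E; ring.
by rewrite -{1}[m]mulr1 -uv; ring.
Qed.

(** What remains of [m] after removing both coefficient terms is divisible by [a] and by [b], hence
    by [a * b]: the division in [level] is exact. *)
Lemma level_eq (a b m : int) : coprimez a b ->
  m = b * coef a b m + a * coef b a m + a * b * level a b m.
Proof.
move=> cab; have cba : coprimez b a by rewrite coprimez_sym.
have /dvdzP[c Ec] := dvdz_sub_coef m cab.
have /dvdzP[d Ed] := dvdz_sub_coef m cba.
have : (a * b %| m - b * coef a b m - a * coef b a m)%Z.
  rewrite Gauss_dvdz //; apply/andP; split; apply/dvdzP.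
    by exists (c - coef b a m); rewrite Ec; ring.
  by exists (d - coef a b m); rewrite mulrBl -Ed; ring.
rewrite /level; move/divzK => E; rewrite [a * b * _]mulrC E; ring.
Qed.

(** Modulo [a] only the [j] terms survive, and [b] is invertible there; the rest, divided by [a], is
    a Euclidean division by [b]. *)
Lemma coefs_unique (a b j j' r r' f f' : int) : coprimez a b ->
  0 <= j < a -> 0 <= j' < a -> 0 <= r < b -> 0 <= r' < b ->
  b * j + a * r + a * b * f = b * j' + a * r' + a * b * f' ->
  [/\ j = j', r = r' & f = f'].
Proof.
move=> cab j_a j'_a r_b r'_b E.
have ej : j = j'.
  have /dvdzP[c Ec] : (a %| j - j')%Z.
    rewrite -(Gauss_dvdzr _ cab); apply/dvdzP.
    by exists (r' - r + b * (f' - f)); lia.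
  have c0 : c = 0 by nia.
  by nia.
have er : r = r'.
  have aN : a != 0 by lia.
  subst j'; apply/eqP; have /eqP := E.
  have -> : (b * j + a * r + a * b * f == b * j + a * r' + a * b * f') =
           (a * (r + b * f) == a * (r' + b * f')).
    by apply/idP/idP => /eqP H; apply/eqP; lia.
  move/eqP/(mulfI aN) => H.
  have : f = f' by nia.
  by move=> ?; subst f'; apply/eqP; lia.
split=> //; subst j' r'.
have : a * b != 0 by nia.
by move/mulfI; apply; lia.
Qed.

Lemma level_coef (a b m j r f : int) : coprimez a b ->
  0 <= j < a -> 0 <= r < b -> m = b * j + a * r + a * b * f ->
  [/\ coef a b m = j, coef b a m = r & level a b m = f].
Proof.
move=> cab j_a r_b Em; apply: (coefs_unique cab) => //.
- by apply: coef_bounds; lia.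
- by apply: coef_bounds; lia.
- by rewrite -level_eq.
Qed.

(** Dividing [j] by [a] and [j'] by [b] leaves two quotients in [[0, q - 1]], and the level is their
    sum. *)
Lemma level_ge0_lt (a b q m : int) : coprimez a b -> 0 < a -> 0 < b ->
  (exists j j', [/\ 0 <= j < q * a, 0 <= j' < q * b & m = b * j + a * j'])
  <-> 0 <= level a b m < 2 * q - 1.
Proof.
move=> cab a_gt0 b_gt0; split.
  move=> [j [j' [j_lt j'_lt Em]]].
  have Ej := divz_eq j a; have Ej' := divz_eq j' b.
  have := ltz_pmod j a_gt0; have := ltz_pmod j' b_gt0.
  have := @modz_ge0 j a _; have := @modz_ge0 j' b _.
  rewrite !gt_eqF // => /(_ isT) + /(_ isT).
  move: Ej Ej'.
  set i := (_ %/ _)%Z; set k := (_ %% _)%Z.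
  set i' := (_ %/ _)%Z; set k' := (_ %% _)%Z => Ej Ej' k'0 k0 k'b ka.
  have [||| _ _ ->] := @level_coef a b m k k' (i + i') cab.
  - by lia.
  - by lia.
  - by rewrite Em Ej Ej'; ring.
  have : 0 <= i by nia.
  have : i < q by nia.
  have : 0 <= i' by nia.
  have : i' < q by nia.
  by lia.
have := coef_bounds b m a_gt0; have := coef_bounds a m b_gt0.
have := level_eq m cab.
set j := coef a b m; set r := coef b a m; set f := level a b m.
move=> Em r_b j_a f_q.
(* The level is spent on [j] up to [q - 1], and any excess on [j']. *)
have [fq|qf] := ltP f q.
  exists (j + a * f), r; split; nia.
exists (j + a * (q - 1)), (r + b * (f - (q - 1))); split; nia.
Qed.

(** The new coefficients are [j + y] and [r + x] reduced modulo [a] and [b]; the quotients carry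
    into the level. *)
Lemma level_add (a b x y N m : int) : coprimez a b -> 0 < a -> 0 < b ->
  level a b (m + (x * a + y * b + a * b * N)) =
    level a b m + N + ((coef a b m + y) %/ a)%Z + ((coef b a m + x) %/ b)%Z.
Proof.
move=> cab a_gt0 b_gt0; set j := coef a b m; set r := coef b a m.
have [||| _ _ ->] // := @level_coef a b (m + (x * a + y * b + a * b * N))
  ((j + y) %% a)%Z ((r + x) %% b)%Z
  (level a b m + N + ((j + y) %/ a)%Z + ((r + x) %/ b)%Z) cab.
- by rewrite modz_ge0 ?ltz_pmod ?gt_eqF.
- by rewrite modz_ge0 ?ltz_pmod ?gt_eqF.
rewrite {1}(level_eq m cab) -/j -/r.
have E := divz_eq (j + y) a; have E' := divz_eq (r + x) b.
have -> : x = (r + x) - r by ring.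
have -> : y = (j + y) - j by ring.
have -> : j + (j + y - j) = j + y by ring.
have -> : r + (r + x - r) = r + x by ring.
rewrite {1}E {1}E'; ring.
Qed.

(** The coefficient part [b * j + a * r] lies between 0 and [2 * a * b], the upper bound being
    strict. *)
Lemma level_sign (a b m : int) : coprimez a b -> 0 < a -> 0 < b ->
  (m < 0 -> level a b m < 0) /\ (2 * a * b <= m -> 0 <= level a b m).
Proof.
move=> cab a_gt0 b_gt0.
have := coef_bounds b m a_gt0; have := coef_bounds a m b_gt0.
have := level_eq m cab.
set j := coef a b m; set r := coef b a m; set f := level a b m.
move=> Em r_b j_a; split=> ?; apply: contraT; rewrite -?leNgt -?ltNge => ?.
  have : 0 <= a * b * f by apply: mulr_ge0; nia.
  nia.
have : a * b * f <= a * b * -1 by rewrite ler_pM2l; nia.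
nia.
Qed.

(** * Residue classes that jump over a range of levels *)

Definition uncovered (a b N n w : int) : Prop :=
  forall l : int, ~~ (0 <= level a b (w + l * n) < N).

Lemma uncovered_shift (a b N n w l : int) :
  uncovered a b N n w -> uncovered a b N n (w + l * n).
Proof. by move=> U k; have := U (l + k); rewrite mulrDl addrA. Qed.

(** Starting from a negative level, the first nonnegative level met along the class avoids [[0, N)],
    so it is at least [N]. *)
Lemma uncovered_crossing (a b N n w : int) :
  coprimez a b -> 0 < a -> 0 < b -> 0 < n -> uncovered a b N n w ->
  exists l, level a b (w + l * n) < 0 /\ N <= level a b (w + l * n + n).
Proof.
move=> cab a_gt0 b_gt0 n_gt0 U.
(* The offset makes [W 0] negative; the index chosen below gives [w + (|w| + 2ab) * n], which is at
   least [2ab]. *)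
pose W (i : nat) := w + (i%:Z - `|w| - 1) * n.
have hi : exists i, 0 <= level a b (W i).
  pose i := absz (`|w| + `|w| + 1 + 2 * a * b); exists i.
  by have [_] := level_sign (W i) cab a_gt0 b_gt0; apply; rewrite /W; nia.
case: (ex_minnP hi) => [[|i] Pi min_i].
  have [W0_lt0 _] := level_sign (W 0%N) cab a_gt0 b_gt0.
  have /W0_lt0 : W 0%N < 0 by rewrite /W; nia.
  by rewrite ltNge Pi.
exists (i%:Z - `|w| - 1); split.
  by rewrite ltNge; apply/negP => /min_i; rewrite ltnn.
have E : w + (i%:Z - `|w| - 1) * n + n = W i.+1 by rewrite /W; lia.
by rewrite E; have := U (i.+1%:Z - `|w| - 1); rewrite -/(W i.+1) Pi /= -leNgt.
Qed.

(** The carry from [j] is at most 1 and the one from [r] at most 0, so a step raises the level by at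
    most [N]: a negative level cannot reach [N]. *)
Lemma not_uncovered (a b x y N w : int) :
  coprimez a b -> 0 < a -> 0 < b -> x <= 0 -> y <= a ->
  0 < x * a + y * b + a * b * (N - 1) ->
  ~ uncovered a b N (x * a + y * b + a * b * (N - 1)) w.
Proof.
move=> cab a_gt0 b_gt0 x_le0 y_le n_gt0 U.
have [l []] := uncovered_crossing cab a_gt0 b_gt0 n_gt0 U.
rewrite level_add //.
set m := w + _.
have := coef_bounds b m a_gt0; have := coef_bounds a m b_gt0.
have := divz_eq (coef a b m + y) a; have := divz_eq (coef b a m + x) b.
have := @modz_ge0 (coef a b m + y) a; have := @modz_ge0 (coef b a m + x) b.
rewrite !gt_eqF // => /(_ isT) + /(_ isT).
set c := (_ %/ a)%Z; set d := (_ %/ b)%Z => ? ? ? ? ? ?.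
have : c < 2 by nia.
have : d < 1 by nia.
lia.
Qed.

Lemma level_homo (a b x y N m l : int) :
  coprimez a b -> 0 < a -> 0 < b -> 0 <= x -> 0 <= y -> 0 <= N -> 0 <= l ->
  level a b m <= level a b (m + l * (x * a + y * b + a * b * N)).
Proof.
move=> cab a_gt0 b_gt0 x_ge0 y_ge0 N_ge0.
set n := _ + _ * N; case: l => // l _; elim: l => [|l IHl].
  by rewrite mul0r addr0.
have -> : m + l.+1%:Z * n = m + l%:Z * n + n by lia.
apply: le_trans IHl _; rewrite level_add //; set m' := m + _.
have := coef_bounds b m' a_gt0; have := coef_bounds a m' b_gt0 => ? ?.
have ? : 0 <= ((coef a b m' + y) %/ a)%Z by rewrite divz_ge0 //; lia.
have ? : 0 <= ((coef b a m' + x) %/ b)%Z by rewrite divz_ge0 //; lia.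
lia.
Qed.

(** By monotonicity the levels stay negative up to [m] and at least [N] from [m + n] on. *)
Lemma crossing_uncovered (a b x y N m : int) :
  coprimez a b -> 0 < a -> 0 < b -> 0 <= x -> 0 <= y -> 1 <= N ->
  let n := x * a + y * b + a * b * (N - 1) in
  level a b m < 0 -> N <= level a b (m + n) -> uncovered a b N n m.
Proof.
move=> cab a_gt0 b_gt0 x_ge0 y_ge0 N_ge1 n m_lt0 mn_ge l.
have [l_le0|l_gt0] := leP l 0.
  have := @level_homo a b x y (N - 1) (m + l * n) (- l).
  rewrite -/n; have -> : m + l * n + - l * n = m by ring.
  by move=> H; have := H cab a_gt0 b_gt0 x_ge0 y_ge0; lia.
have := @level_homo a b x y (N - 1) (m + n) (l - 1).
rewrite -/n; have -> : m + n + (l - 1) * n = m + l * n by ring.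
by move=> H; have := H cab a_gt0 b_gt0 x_ge0 y_ge0; lia.
Qed.

(** After the jump no level is negative again. Used in both directions, this shows that a class has
    a single crossing. *)
Lemma crossing_unique (a b x y N m l : int) :
  coprimez a b -> 0 < a -> 0 < b -> 0 <= x -> 0 <= y -> 1 <= N ->
  let n := x * a + y * b + a * b * (N - 1) in
  N <= level a b (m + n) -> level a b (m + l * n) < 0 -> l <= 0.
Proof.
move=> cab a_gt0 b_gt0 x_ge0 y_ge0 N_ge1 n mn_ge ml_lt0.
rewrite leNgt; apply/negP => l_gt0.
have := @level_homo a b x y (N - 1) (m + n) (l - 1).
rewrite -/n; have -> : m + n + (l - 1) * n = m + l * n by ring.
by move=> H; have := H cab a_gt0 b_gt0 x_ge0 y_ge0; lia.
Qed.

(** * Counting the uncovered classes *)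

Lemma sum_divn_add (d x : nat) : (0 < d)%N -> (\sum_(r < d) (r + x) %/ d = x)%N.
Proof.
move=> d_gt0; elim: x => [|x IHx].
  by apply: big1 => r _; rewrite addn0 divn_small.
pose f r := ((r + x) %/ d)%N.
(* Hermite's identity by induction: peeling off the first or the last term gives the sums for [x.+1]
   and [x], and these two terms differ by 1. *)
have : (\sum_(r < d.+1) f r = \sum_(r < d.+1) f r)%N by [].
rewrite {1}big_ord_recl big_ord_recr /= IHx /f add0n divnDl // divnn d_gt0.
under eq_bigr do rewrite /bump leq0n add1n addSnnS.
lia.
Qed.

Lemma card_tagged_lt (I : finType) (F : I -> nat) (M : nat) :
  (forall i, F i <= M)%N ->
  #|[set t : I * 'I_M | (t.2 < F t.1)%N]| = (\sum_i F i)%N.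
Proof.
move=> FM; rewrite -sum1dep_card.
rewrite -(pair_big_dep xpredT (fun i (e : 'I_M) => e < F i)%N (fun _ _ => 1%N)) /=.
apply: eq_bigr => i _.
rewrite -(big_ord_widen M (fun _ => 1%N) (FM i)) sum1_card card_ord //.
Qed.

(** As [Q] is invertible modulo [n], [k * Q + C] meets each residue class once; an uncovered class
    is represented by its unique crossing. *)
Lemma card_uncovered (a b x y q n : nat) (Q Q' C : int) :
  coprime a b -> (0 < a)%N -> (0 < b)%N -> (0 < q)%N -> (0 < n)%N ->
  n%:Z = x%:Z * a%:Z + y%:Z * b%:Z + a%:Z * b%:Z * (2 * q%:Z - 1 - 1) ->
  (n%:Z %| Q * Q' - 1)%Z ->
  #|[pred k : 'I_n |
       `[< uncovered a%:Z b%:Z (2 * q%:Z - 1) n%:Z (k%:Z * Q + C) >]]|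
  = (\sum_(j < a) \sum_(r < b) ((j + y) %/ a + (r + x) %/ b - 1))%N.
Proof.
move=> cab a_gt0 b_gt0 q_gt0 n_gt0 En /dvdzP[h Eh].
have cabz : coprimez a%:Z b%:Z by rewrite coprimezE.
have ? : 0 < n%:Z by lia.
have ? : 0 < a%:Z by lia.
have ? : 0 < b%:Z by lia.
have ? : 0 <= x%:Z by lia.
have ? : 0 <= y%:Z by lia.
have N_ge1 : 1 <= 2 * q%:Z - 1 by lia.
set N := 2 * q%:Z - 1 in En N_ge1 *.
pose F (p : 'I_a * 'I_b) := ((p.1 + y) %/ a + (p.2 + x) %/ b - 1)%N.
pose M := (x + y).+2.
have FM p : (F p <= M)%N.
  rewrite /F /M; case: p => [[j ja] [r rb]] /=.
  have : ((j + y) %/ a <= y.+1)%N.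
    by rewrite -ltnS ltn_divLR //; nia.
  have : ((r + x) %/ b <= x.+1)%N.
    by rewrite -ltnS ltn_divLR //; nia.
  lia.
rewrite (pair_bigA _ (fun j r => F (j, r))) /=.
under eq_bigr do rewrite -surjective_pairing.
rewrite -(card_tagged_lt FM).
set D := [set t | _].
(* The triple [(j, r, e)] encodes the integer with coefficients [j], [r] and negative level
   [- e - 1]. *)
pose m (t : 'I_a * 'I_b * 'I_M) : int :=
  b%:Z * t.1.1%:Z + a%:Z * t.1.2%:Z + a%:Z * b%:Z * (- t.2%:Z - 1).
have mP t : [/\ coef a%:Z b%:Z (m t) = t.1.1%:Z, coef b%:Z a%:Z (m t) = t.1.2%:Z
              & level a%:Z b%:Z (m t) = - t.2%:Z - 1].
  by apply: level_coef => //; case: t => [[[j ja] [r rb]] e] /=; lia.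
have m_lt0 t : level a%:Z b%:Z (m t) < 0.
  by have [_ _ ->] := mP t; lia.
have lev_mn t : level a%:Z b%:Z (m t + n%:Z) =
    - t.2%:Z - 1 + (N - 1) + ((t.1.1 + y) %/ a)%N%:Z + ((t.1.2 + x) %/ b)%N%:Z.
  have [E1 E2 E3] := mP t.
  by rewrite En level_add // E1 E2 E3 -!PoszD !divz_nat.
(* With quotients [c] and [d], jumping to [N] means [- e - 1 + (N - 1) + c + d >= N], that is
   [e < c + d - 1]. *)
have DP t : (t \in D) = (N <= level a%:Z b%:Z (m t + n%:Z)).
  rewrite inE lev_mn /F.
  by move: (nat_of_ord t.2) (_ %/ a)%N (_ %/ b)%N => e c d; apply/idP/idP; lia.
(* The index [g t] solves [k * Q + C = m t] modulo [n]. *)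
have g_lt t : (absz ((m t - C) * Q' %% n%:Z)%Z < n)%N.
  have := ltz_pmod ((m t - C) * Q') (_ : 0 < n%:Z).
  by have := @modz_ge0 ((m t - C) * Q') n%:Z; lia.
pose g t : 'I_n := Ordinal (g_lt t).
have gE t : exists l, (g t)%:Z * Q + C = m t + l * n%:Z.
  have -> : (g t)%:Z = ((m t - C) * Q' %% n%:Z)%Z.
    by rewrite /= gez0_abs // modz_ge0 //; lia.
  have E := divz_eq ((m t - C) * Q') n%:Z.
  exists ((m t - C) * h - ((m t - C) * Q' %/ n%:Z)%Z * Q).
  have -> : ((m t - C) * Q' %% n%:Z)%Z =
    (m t - C) * Q' - ((m t - C) * Q' %/ n%:Z)%Z * n%:Z by rewrite {2}E; ring.
  transitivity ((m t - C) * (Q * Q' - 1) + m t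
    - ((m t - C) * Q' %/ n%:Z)%Z * n%:Z * Q); first by ring.
  by rewrite Eh; ring.
have m_inj t t' : m t = m t' -> t = t'.
  move=> E; have := mP t; rewrite E; have [-> -> ->] := mP t'.
  case: t t' {E} => [[j r] e] [[j' r'] e'] /= [[/esym ej] [/esym er] ee].
  by congr (_, _, _); apply: val_inj => //=; lia.
rewrite -(@card_in_imset _ _ g D); last first.
  move=> t t' tD t'D gtt'; apply: m_inj.
  have [l El] := gE t; have [l' El'] := gE t'.
  rewrite gtt' in El.
  have Em : m t' = m t + (l - l') * n%:Z by lia.
  have Em' : m t = m t' + (l' - l) * n%:Z by lia.
  rewrite !DP in tD t'D.
  have L : l - l' <= 0.
    apply: (@crossing_unique a%:Z b%:Z x%:Z y%:Z N (m t)) => //.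
      by rewrite -En.
    by rewrite -En -Em.
  have L' : l' - l <= 0.
    apply: (@crossing_unique a%:Z b%:Z x%:Z y%:Z N (m t')) => //.
      by rewrite -En.
    by rewrite -En -Em'.
  have ll' : l = l' by lia.
  by rewrite Em ll' subrr mul0r addr0.
apply: eq_card => k; rewrite inE; apply/asboolP/imsetP => [U|[t tD ->]]; last first.
  have [l ->] := gE t; apply: uncovered_shift; rewrite En.
  by apply: crossing_uncovered => //; rewrite -En -DP.
(* Surjectivity: the crossing [w] of the class of [k] is read back as a triple. *)
have [||| l []] := uncovered_crossing cabz _ _ _ U => //.
set w := _ + l * _ => w_lt0 w_ge.
have j_b := coef_bounds b%:Z w (_ : 0 < a%:Z).
have r_b := coef_bounds a%:Z w (_ : 0 < b%:Z).
have jl : (absz (coef a%:Z b%:Z w) < a)%N by lia.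
have rl : (absz (coef b%:Z a%:Z w) < b)%N by lia.
pose e := absz (- level a%:Z b%:Z w - 1).
have eE : e%:Z = - level a%:Z b%:Z w - 1 by rewrite /e; lia.
have eF : (e < F (Ordinal jl, Ordinal rl))%N.
  move: w_ge; rewrite En level_add // /F /=.
  have -> : coef a%:Z b%:Z w = (absz (coef a%:Z b%:Z w))%:Z by lia.
  have -> : coef b%:Z a%:Z w = (absz (coef b%:Z a%:Z w))%:Z by lia.
  rewrite !absz_nat -!PoszD !divz_nat.
  by set c := (_ %/ a)%N; set d := (_ %/ b)%N; lia.
have eM : (e < M)%N by apply: leq_trans eF (FM _).
pose t := ((Ordinal jl, Ordinal rl), Ordinal eM).
have mt : m t = w.
  rewrite /m (level_eq w cabz) /= eE.
  by congr (_ * _ + _ * _ + _ * _); lia.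
exists t; first by rewrite inE.
apply: val_inj => /=; rewrite mt.
have -> : (w - C) * Q' = k%:Z + (l * Q' + k%:Z * h) * n%:Z.
  have -> : (w - C) * Q' = k%:Z * (Q * Q' - 1) + k%:Z + l * n%:Z * Q'.
    by rewrite /w; ring.
  by rewrite Eh; ring.
by rewrite addrC modzMDl modz_nat absz_nat modn_small.
Qed.

(** * Letters of rotated and Christoffel words *)

Lemma size_iter_gamma (w : seq letter) (k : nat) : size (iter k gamma w) = size w.
Proof. by elim: k => //= k; rewrite size_rot. Qed.

Lemma nth_iter_gamma (w : seq letter) (k i : nat) : (i < size w)%N ->
  nth Lz (iter k gamma w) i = nth Lz w ((i + k) %% size w).
Proof.
elim: k i => [|k IHk] i i_lt; first by rewrite addn0 modn_small.
have nth_gamma (v : seq letter) : (i < size v)%N ->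
    nth Lz (gamma v) i = nth Lz v (i.+1 %% size v).
  case: v => // c v i_ltv; rewrite /gamma rot1_cons nth_rcons.
  have [i_v|v_i] := ltnP i (size v); first by rewrite modn_small.
  have -> : i = size v by apply/eqP; rewrite eqn_leq v_i andbT -ltnS.
  by rewrite eqxx modnn.
rewrite iterS nth_gamma ?size_iter_gamma // IHk
        ?ltn_mod ?(leq_ltn_trans _ i_lt) //.
by rewrite modnDml addSnnS.
Qed.

Lemma periodize_shiftP (c : letter) (w : seq letter) (k z : int) :
  (0 < size w)%N ->
  periodize (shift (positions c w) k) (size w) z <->
  nth Lz w (absz ((z + k) %% (size w)%:Z)%Z) = c.
Proof.
move=> w_gt0; set n := size w; split.
  move=> [_ [_ [p [p_lt pc] <-] <-] [l _ <-]].
  have -> : p%:Z - k + l * n%:Z + k = l * n%:Z + p%:Z by ring.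
  by rewrite modzMDl modz_nat absz_nat modn_small.
set p := absz _ => pc.
have pE : p%:Z = ((z + k) %% n%:Z)%Z by rewrite /p gez0_abs // modz_ge0 //; lia.
exists (p%:Z - k).
  exists p%:Z => //; exists p => //; split=> //.
  by have := @ltz_pmod (z + k) n%:Z; rewrite -pE; lia.
exists ((z + k) %/ n%:Z)%Z => //.
by rewrite pE; have := divz_eq (z + k) n%:Z; lia.
Qed.

Lemma periodizeP (c : letter) (w : seq letter) (z : int) : (0 < size w)%N ->
  periodize (positions c w) (size w) z <->
  nth Lz w (absz (z %% (size w)%:Z)%Z) = c.
Proof.
move=> w_gt0; rewrite -{2}[z]addr0 -periodize_shiftP //.
suff -> : shift (positions c w) 0 = positions c w by [].
rewrite /shift; under eq_imagel do rewrite subr0.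
exact: image_id.
Qed.

(** Adding [n - s] to the residue of [i * (n - s)] avoids wrapping around exactly when that residue
    is below [s]; the clause for [n = s] fits the same test. The residue is congruent to [- i * s],
    and it is the [j] of the statement. *)
Lemma nth_christoffel (c : letter) (n s i : nat) :
  c <> Lz -> (0 < s <= n)%N -> (i < n)%N ->
  nth Lz (christoffel c n s) i = c <->
  exists2 j : int, 0 <= j < s%:Z & (n%:Z %| i%:Z * s%:Z + j)%Z.
Proof.
move=> cz s_n i_n; rewrite nth_mkseq //.
have n_gt0 : (0 < n)%N by lia.
have -> : ((n - s == 0) || ((i * (n - s)) %% n < (i.+1 * (n - s)) %% n) =
           ((i * (n - s)) %% n < s))%N.
  rewrite mulSn -modnDmr; have := ltn_pmod (i * (n - s)) n_gt0.
  set r := (_ %% n)%N => r_n.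
  have [le_n|gt_n] := ltnP (n - s + r) n; first by rewrite modn_small //; lia.
  have -> : (n - s + r = n + (r - s))%N by lia.
  by rewrite modnDl modn_small; lia.
have E := divz_eq (i * (n - s))%N%:Z n%:Z.
rewrite modz_nat in E.
have Es : (n - s)%N%:Z = n%:Z - s%:Z by lia.
have rE : ((i * (n - s)) %% n < s)%N <->
    exists2 j : int, 0 <= j < s%:Z & (n%:Z %| i%:Z * s%:Z + j)%Z.
  split=> [r_s|[j j_s /dvdzP[h Eh]]].
    exists ((i * (n - s)) %% n)%N%:Z; first by lia.
    apply/dvdzP; exists (i%:Z - ((i * (n - s))%N%:Z %/ n%:Z)%Z).
    by rewrite PoszM Es in E *; rewrite mulrBl; lia.
  have : ((i * (n - s))%N%:Z %% n%:Z)%Z = j.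
    have -> : (i * (n - s))%N%:Z = (i%:Z - h) * n%:Z + j.
      by rewrite PoszM Es mulrBl; lia.
    by rewrite modzMDl modz_small //; lia.
  by rewrite modz_nat; lia.
by rewrite -rE; case: ifP => _; split=> // /esym.
Qed.

Lemma dvdz_modDl (n z s j : int) :
  (n %| (z %% n)%Z * s + j)%Z = (n %| z * s + j)%Z.
Proof.
have E := divz_eq z n; set r := (z %% n)%Z in E *; set h := (z %/ n)%Z in E.
apply/dvdzP/dvdzP => -[l El].
  by exists (l + h * s); rewrite [RHS]mulrDl -El E; ring.
by exists (l - h * s); rewrite [RHS]mulrBl -El E; ring.
Qed.

Lemma christoffel_at (c : letter) (n s : nat) (z : int) :
  c <> Lz -> (0 < s <= n)%N ->
  nth Lz (christoffel c n s) (absz (z %% n%:Z)%Z) = c <->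
  exists2 j : int, 0 <= j < s%:Z & (n%:Z %| z * s%:Z + j)%Z.
Proof.
move=> cz s_n; have n_gt0 : 0 < n%:Z by lia.
have := @modz_ge0 z n%:Z; have := ltz_pmod z n_gt0 => ? ?.
rewrite nth_christoffel //; last by lia.
have -> : (absz (z %% n%:Z)%Z)%:Z = (z %% n%:Z)%Z by lia.
by split=> -[j j_s]; rewrite ?dvdz_modDl => dv; exists j; rewrite ?dvdz_modDl.
Qed.

(** * From common positions to levels *)

(** Multiplying the two congruences by [b] and [a] and subtracting eliminates [z] and leaves
    [b * j - a * j']. The reflection of [j'] into [q * b - 1 - j'] turns this into a sum, whence the
    constant [a * (q * b - 1)]. *)
Lemma common_residue_level (n q a b k : int) :
  0 < a -> 0 < b -> coprimez a b -> coprimez n (q * a) ->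
  (exists z, (exists2 j, 0 <= j < q * a & (n %| z * (q * a) + j)%Z) /\
             (exists2 j, 0 <= j < q * b & (n %| (z + k) * (q * b) + j)%Z)) <->
  (exists l, 0 <= level a b (k * (q * a * b) + a * (q * b - 1) + l * n)
             < 2 * q - 1).
Proof.
move=> a_gt0 b_gt0 cab cn; split.
  move=> [z [[j j_lt /dvdzP[h Eh]] [j' j'_lt /dvdzP[h' Eh']]]].
  exists (b * h - a * h'); rewrite -level_ge0_lt //.
  exists j, (q * b - 1 - j'); split=> //; first by lia.
  have -> : (b * h - a * h') * n = b * (h * n) - a * (h' * n) by ring.
  by rewrite -Eh -Eh'; ring.
move=> [l]; rewrite -level_ge0_lt // => -[j [i [j_lt i_lt Ei]]].
have /coprimezP[[u v] /= uv] := cn.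
have can : coprimez n a by move: cn; rewrite coprimezMr => /andP[].
(* [v] inverts [q * a] modulo [n]. *)
exists (- j * v); split.
  exists j => //; apply/dvdzP; exists (j * u).
  by rewrite -{2}[j]mulr1 -uv; ring.
exists (q * b - 1 - i); first by lia.
(* Divisibility is tested after multiplication by [a], a unit modulo [n]. *)
rewrite -(Gauss_dvdzr _ can); apply/dvdzP; exists (b * j * u - l).
transitivity (k * (q * a * b) + a * (q * b - 1) + l * n - a * i - l * n
              - b * j * (v * (q * a))); first by ring.
have -> : v * (q * a) = 1 - u * n by rewrite -uv; ring.
by rewrite Ei; ring.
Qed.

(** * Evaluation of the double sum *)

(** Both quotients are 0 or 1, so the truncated [c + d - 1] equals [c * d] and the double sum
    factors. *)
Lemma sum_crossings_le (a b x y : nat) : (0 < a)%N -> (0 < b)%N ->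
  (0 < x <= b)%N -> (0 < y <= a)%N ->
  (\sum_(j < a) \sum_(r < b) ((j + y) %/ a + (r + x) %/ b - 1) = x * y)%N.
Proof.
move=> a_gt0 b_gt0 x_b y_a.
rewrite -{2}(sum_divn_add x b_gt0) -{2}(sum_divn_add y a_gt0) mulnC big_distrlr.
apply: eq_bigr => -[j ja] _; apply: eq_bigr => -[r rb] _ /=.
have : ((j + y) %/ a < 2)%N by rewrite ltn_divLR //; lia.
have : ((r + x) %/ b < 2)%N by rewrite ltn_divLR //; lia.
by case: (_ %/ b)%N => [|[]] //; case: (_ %/ a)%N => [|[]].
Qed.

(** Here [(r + x) %/ b] is at least 1, so no subtraction is truncated and the sum splits
    linearly. *)
Lemma sum_crossings_ge (a b x y : nat) : (0 < a)%N -> (0 < b)%N ->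
  (b <= x)%N ->
  (\sum_(j < a) \sum_(r < b) ((j + y) %/ a + (r + x) %/ b - 1) + a * b =
   x * a + y * b)%N.
Proof.
move=> a_gt0 b_gt0 b_x.
have -> : (a * b = \sum_(j < a) \sum_(r < b) 1)%N.
  by rewrite !sum_nat_const !card_ord muln1.
rewrite -big_split /=.
under eq_bigr => j _.
  rewrite -big_split /=.
  under eq_bigr => r _.
    rewrite subnK; first over.
    by rewrite addn_gt0 [X in _ || X]divn_gt0 // (leq_trans b_x) ?orbT // leq_addl.
  rewrite big_split /= sum_divn_add // sum_nat_const card_ord.
  over.
by rewrite big_split /= -big_distrr /= sum_divn_add // sum_nat_const card_ord; lia.
Qed.

(** * Superimpositions as uncovered classes *)

Lemma christoffel_disjointP (n q a b : nat) (k : int) :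
  (0 < n)%N -> (0 < q)%N -> (0 < a)%N -> (0 < b)%N -> coprime a b ->
  (q * a <= n)%N -> coprime n (q * a) -> (q * b <= n)%N ->
  (forall z, ~ (nth Lz (christoffel La n (q * a)) (absz (z %% n%:Z)%Z) = La /\
        nth Lz (christoffel Lb n (q * b)) (absz ((z + k) %% n%:Z)%Z) = Lb)) <->
  uncovered a%:Z b%:Z (2 * q%:Z - 1) n%:Z
    (k * (q%:Z * a%:Z * b%:Z) + a%:Z * (q%:Z * b%:Z - 1)).
Proof.
move=> n_gt0 q_gt0 a_gt0 b_gt0 cab qa_n cn qb_n.
have aZ : 0 < a%:Z by lia.
have bZ : 0 < b%:Z by lia.
have cabZ : coprimez a%:Z b%:Z by rewrite coprimezE.
have cnZ : coprimez n%:Z (q%:Z * a%:Z) by rewrite -PoszM coprimezE.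
have H := common_residue_level k aZ bZ cabZ cnZ.
have P z : (nth Lz (christoffel La n (q * a)) (absz (z %% n%:Z)%Z) = La /\
   nth Lz (christoffel Lb n (q * b)) (absz ((z + k) %% n%:Z)%Z) = Lb) <->
  (exists2 j, 0 <= j < q%:Z * a%:Z & (n%:Z %| z * (q%:Z * a%:Z) + j)%Z) /\
  (exists2 j, 0 <= j < q%:Z * b%:Z & (n%:Z %| (z + k) * (q%:Z * b%:Z) + j)%Z).
  by rewrite -!PoszM !christoffel_at // ?muln_gt0 ?q_gt0 ?a_gt0 ?b_gt0.
split=> [D l|U z /P Pz].
  by apply/negP => L; have [z /P/D] : _ := (proj2 H (ex_intro _ l L)).
by have [l L] := proj1 H (ex_intro _ z Pz); have := U l; rewrite L.
Qed.

Lemma superimpositionP (n q a b : nat) (k : int) :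
  (0 < n)%N -> (0 < q)%N -> (0 < a)%N -> (0 < b)%N -> coprime a b ->
  (q * a <= n)%N -> coprime n (q * a) -> (q * b <= n)%N ->
  let u := christoffel La n (q * a) in
  let v := christoffel Lb n (q * b) in
  (periodize (positions La u) (size u)
    `&` periodize (shift (positions Lb v) k) (size v) = set0)%classic <->
  uncovered a%:Z b%:Z (2 * q%:Z - 1) n%:Z
    (k * (q%:Z * a%:Z * b%:Z) + a%:Z * (q%:Z * b%:Z - 1)).
Proof.
move=> n_gt0 q_gt0 a_gt0 b_gt0 cab qa_n cn qb_n u v.
rewrite -christoffel_disjointP // -subset0.
have su : size u = n by rewrite size_mkseq.
have sv : size v = n by rewrite size_mkseq.
split=> D z; have := D z.
  move=> {}D [Pu Pv]; apply: D; split.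
    by rewrite periodizeP su.
  by rewrite periodize_shiftP sv.
move=> {}D [Pu Pv]; apply: D; split.
  by rewrite periodizeP su in Pu.
by rewrite periodize_shiftP sv in Pv.
Qed.

(** Rotating [k] times brings the letter at [i + k] to [i], so the periodized positions are those of
    the shift by [k]. *)
Lemma perfectly_superimposableP (n q a b k : nat) :
  (0 < n)%N -> (0 < q)%N -> (0 < a)%N -> (0 < b)%N -> coprime a b ->
  (q * a <= n)%N -> coprime n (q * a) -> (q * b <= n)%N ->
  perfectly_superimposable (christoffel La n (q * a))
    (iter k gamma (christoffel Lb n (q * b))) <->
  uncovered a%:Z b%:Z (2 * q%:Z - 1) n%:Z
    (k%:Z * (q%:Z * a%:Z * b%:Z) + a%:Z * (q%:Z * b%:Z - 1)).
Proof.
move=> n_gt0 q_gt0 a_gt0 b_gt0 cab qa_n cn qb_n.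
rewrite -superimpositionP // /perfectly_superimposable.
set v := christoffel Lb n (q * b).
have sv : size v = n by rewrite size_mkseq.
suff -> : periodize (positions Lb (iter k gamma v)) (size (iter k gamma v)) =
          periodize (shift (positions Lb v) k%:Z) (size v) by [].
apply/funext => z; apply/propext.
rewrite periodizeP ?size_iter_gamma ?sv // -{2}sv periodize_shiftP ?sv //.
have := @modz_ge0 z n%:Z; have := @ltz_pmod z n%:Z => ? ?.
rewrite nth_iter_gamma ?sv; last by lia.
suff -> : ((absz (z %% n)%Z + k) %% n)%N = absz ((z + k%:Z) %% n%:Z)%Z by [].
rewrite -(modzDml z).
have -> : (z %% n)%Z + k%:Z = (absz (z %% n)%Z + k)%N%:Z by lia.
by rewrite modz_nat.
Qed.

Theorem proposition3p31 :
  forall n q alpha beta : nat,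
    (1 <= n)%N -> (1 <= q)%N -> (1 <= alpha)%N -> (1 <= beta)%N ->
    coprime alpha beta ->
    (q * alpha <= n)%N -> coprime n (q * alpha) ->
    (q * beta <= n)%N -> coprime n (q * beta) ->
    superimposable (christoffel La n (q * alpha))
                   (christoffel Lb n (q * beta)) ->
  forall x y : int,
    x * alpha%:Z + y * beta%:Z
      = n%:Z - 2 * alpha%:Z * beta%:Z * (q%:Z - 1) ->
    1 <= y <= alpha%:Z ->
    (x <= beta%:Z ->
       (num_superimpositions n (q * alpha) (q * beta))%:Z = x * y)
    /\
    (beta%:Z < x ->
       (num_superimpositions n (q * alpha) (q * beta))%:Z
         = x * alpha%:Z + y * beta%:Z - alpha%:Z * beta%:Z).
Proof.
move=> n q a b n_gt0 q_gt0 a_gt0 b_gt0 cab qa_n cna qb_n cnb [k0 Dk0] x y Exy y_a.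
have En : n%:Z = x * a%:Z + y * b%:Z + a%:Z * b%:Z * (2 * q%:Z - 1 - 1) by lia.
(* If [x <= 0], no class is uncovered, against the given superimposition. *)
have x_gt0 : 0 < x.
  rewrite ltNge; apply/negP => x_le0.
  have cabZ : coprimez a%:Z b%:Z by rewrite coprimezE.
  move: Dk0; rewrite superimpositionP // En.
  by apply: not_uncovered; rewrite // -?En; lia.
case: x y y_a Exy En x_gt0 => // x [] // y y_a _ En x_gt0.
(* Both coprimality hypotheses on [n] make [q * a * b] a unit modulo [n]. *)
have [Q' dvQ] : exists Q', (n%:Z %| q%:Z * a%:Z * b%:Z * Q' - 1)%Z.
  have : coprimez (q%:Z * a%:Z * b%:Z) n%:Z.
    rewrite coprimez_sym -!PoszM coprimezE /= coprimeMr cna.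
    by move: cnb; rewrite coprimeMr => /andP[].
  move=> /coprimezP[[u v] /= uv]; exists u; apply/dvdzP; exists (- v).
  by rewrite -uv; ring.
have -> : num_superimpositions n (q * a) (q * b) =
   (\sum_(j < a) \sum_(r < b) ((j + y) %/ a + (r + x) %/ b - 1))%N.
  rewrite -(card_uncovered (a%:Z * (q%:Z * b%:Z - 1)) cab a_gt0 b_gt0 q_gt0
              n_gt0 En dvQ).
  apply: eq_card => k; rewrite !inE; apply: asbool_equiv_eq.
  exact: perfectly_superimposableP.
split=> x_b.
  by rewrite sum_crossings_le //; lia.
by have := @sum_crossings_ge a b x y a_gt0 b_gt0; lia.
Qed.
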